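(* Let $b>1$ be an integer, let $a$ be a positive integer coprime to $b$, let $m=\frac ab$, $R=\mathbb{Z}[\frac1b]$, $\Gamma=\mathrm{SL}(2,R)$, and let $G=G(m)=\langle A(m),B(m)\rangle\le\Gamma$. Suppose that $G$ is $S$-arithmetic (i.e. $G$ has finite index in $\Gamma$). Then $G$ is not a free group.
   Context: For $x\in\mathbb{C}$, $A(x)=\begin{bmatrix}1&x\\ 0&1\end{bmatrix}$ and $B(x)=\begin{bmatrix}1&0\\ x&1\end{bmatrix}$. $R=\mathbb{Z}[\frac1b]=\{r/b^i \mid r\in\mathbb{Z},\ i\ge 0\}$. A subgroup of $\Gamma=\mathrm{SL}(2,R)$ is called $S$-arithmetic if it has finite index in $\Gamma$. (It is known that $\Gamma$ has the congruence subgroup property: each finite index subgroup contains the kernel of the reduction homomorphism $\Gamma\to\mathrm{SL}(2,R/tR)$ for some positive integer $t$ coprime to $b$.) *)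

(* Defs.v *)
From HB Require Import structures.
From mathcomp Require Import all_boot all_order all_algebra.
From mathcomp Require Import boolp classical_sets functions cardinality.

Set Implicit Arguments.
Unset Strict Implicit.
Unset Printing Implicit Defensive.

Import GRing.Theory Num.Theory.

Local Open Scope classical_set_scope.
Local Open Scope ring_scope.

(* Membership in Z[1/b], the subring of the rationals of all r / b ^ i. *)
Definition in_Zinv (b : nat) : {pred rat} :=
  fun x => `[< exists (r : int) (i : nat), x = r%:~R / b%:R ^+ i >].

Record Zinv (b : nat) : Type :=
  MkZinv { Zinv_val : rat; Zinv_valP : Zinv_val \in in_Zinv b }.

HB.instance Definition _ (b : nat) := [isSub for @Zinv_val b].
HB.instance Definition _ (b : nat) := [Choice of Zinv b by <:].

Fact Zinv_subring_closed (b : nat) : subring_closed (in_Zinv b).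
Proof.
have [->|b0] := eqVneq b 0%N.
  have H x : reflect (exists r : int, x = r%:~R) (x \in in_Zinv 0).
    apply: (iffP (asboolP _)) => [[r [[|i] ->]]|[r ->]].
    - by exists r; rewrite expr0 divr1.
    - by exists 0; rewrite expr0n /= invr0 mulr0.
    - by exists r, 0%N; rewrite expr0 divr1.
  split.
  - by apply/H; exists 1.
  - by move=> _ _ /H[r ->] /H[s ->]; apply/H; exists (r - s); rewrite rmorphB.
  - by move=> _ _ /H[r ->] /H[s ->]; apply/H; exists (r * s); rewrite rmorphM.
have nz i : (b%:R : rat) ^+ i != 0 by rewrite expf_neq0 // pnatr_eq0.
split.
- by apply/asboolP; exists 1, 0%N; rewrite expr0 divr1.
- move=> _ _ /asboolP[r [i ->]] /asboolP[s [j ->]]; apply/asboolP.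
  exists (r * b%:Z ^+ j - s * b%:Z ^+ i), (i + j)%N.
  by rewrite -mulNr addf_div ?nz // rmorphB !rmorphM !rmorphXn /= exprD mulNr.
- move=> _ _ /asboolP[r [i ->]] /asboolP[s [j ->]]; apply/asboolP.
  by exists (r * s), (i + j)%N; rewrite mulf_div rmorphM exprD.
Qed.

HB.instance Definition _ (b : nat) :=
  GRing.SubChoice_isSubComNzRing.Build rat (in_Zinv b) (Zinv b)
    (Zinv_subring_closed b).

Fact in_ZinvP (b : nat) (r : int) (i : nat) :
  (r%:~R / b%:R ^+ i : rat) \in in_Zinv b.
Proof. by apply/asboolP; exists r, i. Qed.

Definition Zfrac (b : nat) (r : int) (i : nat) : Zinv b :=
  MkZinv (in_ZinvP b r i).

Record SL (n : nat) (R : comNzRingType) : Type :=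
  MkSL { SL_mx :> 'M[R]_n; SL_mxP : \det SL_mx == 1 }.

HB.instance Definition _ (n : nat) (R : comNzRingType) :=
  [isSub for @SL_mx n R].
HB.instance Definition _ (n : nat) (R : comNzRingType) :=
  [Choice of SL n R by <:].

Section SLGroup.
Variables (n : nat) (R : comNzRingType).
Implicit Types g h : SL n R.

Fact SL_one_subproof : \det (1%:M : 'M[R]_n) == 1.
Proof. by rewrite det1. Qed.

Fact SL_mul_subproof g h : \det (SL_mx g *m SL_mx h) == 1.
Proof. by rewrite det_mulmx (eqP (SL_mxP g)) (eqP (SL_mxP h)) mulr1. Qed.

Fact SL_inv_subproof g : \det (\adj (SL_mx g)) == 1.
Proof.
have := congr1 determinant (mul_mx_adj (SL_mx g)).
by rewrite det_mulmx (eqP (SL_mxP g)) mul1r det1 => ->.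
Qed.

Definition SL_one : SL n R := MkSL SL_one_subproof.
Definition SL_mul g h : SL n R := MkSL (SL_mul_subproof g h).
Definition SL_inv g : SL n R := MkSL (SL_inv_subproof g).

Fact SL_mulA : associative SL_mul.
Proof. by move=> g h k; apply/val_inj/mulmxA. Qed.

Fact SL_mul1 : left_id SL_one SL_mul.
Proof. by move=> g; apply/val_inj/mul1mx. Qed.

Fact SL_mulr1 : right_id SL_one SL_mul.
Proof. by move=> g; apply/val_inj/mulmx1. Qed.

Fact SL_mulV : left_inverse SL_one SL_inv SL_mul.
Proof.
by move=> g; apply/val_inj; rewrite /= mul_adj_mx (eqP (SL_mxP g)).
Qed.

Fact SL_mulrV : right_inverse SL_one SL_inv SL_mul.
Proof.
by move=> g; apply/val_inj; rewrite /= mul_mx_adj (eqP (SL_mxP g)).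
Qed.

HB.instance Definition _ :=
  isGroup.Build (SL n R) SL_mulA SL_mul1 SL_mulr1 SL_mulV SL_mulrV.

End SLGroup.

Section Elementary.
Variable R : comNzRingType.

Definition mx2 (a b c d : R) : 'M[R]_2 :=
  \matrix_(i < 2, j < 2) (nth [::] [:: [:: a; b]; [:: c; d]] i)`_j.

Fact det_mx2 (a b c d : R) : \det (mx2 a b c d) = a * d - b * c.
Proof.
rewrite (expand_det_row _ ord0) !big_ord_recl big_ord0 addr0 /cofactor !det_mx11.
by rewrite !mxE /= expr0 expr1 mul1r mulN1r mulrN.
Qed.

Fact A_subproof (x : R) : \det (mx2 1 x 0 1) == 1.
Proof. by rewrite det_mx2 mulr1 mulr0 subr0. Qed.

Fact B_subproof (x : R) : \det (mx2 1 0 x 1) == 1.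
Proof. by rewrite det_mx2 mulr1 mul0r subr0. Qed.

Definition A (x : R) : SL 2 R := MkSL (A_subproof x).
Definition B (x : R) : SL 2 R := MkSL (B_subproof x).

End Elementary.

Definition is_subgroup (gT : groupType) (H : set gT) : Prop :=
  group_closed (mem H).

Definition generated (gT : groupType) (S : set gT) : set gT :=
  smallest (@is_subgroup gT) S.

(* The subgroup generated by S as a group in its own right: freeness is
   a property of a groupType, not of a subset of one. *)
Record generated_group (gT : groupType) (S : set gT) : Type :=
  MkGenerated { generated_val : gT; _ : generated_val \in generated S }.

HB.instance Definition _ (gT : groupType) (S : set gT) :=
  [isSub for @generated_val gT S].
HB.instance Definition _ (gT : groupType) (S : set gT) :=
  [Choice of generated_group S by <:].

Fact generated_closed (gT : groupType) (S : set gT) :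
  group_closed (fun x => x \in generated S).
Proof.
split=> [|x y]; rewrite ?inE; first by move=> H [[H1 _] _]; rewrite inE in H1.
move=> xS yS H HP; have [[_ Hdiv] _] := HP.
by move: (Hdiv x y); rewrite !inE; apply; [apply: xS|apply: yS].
Qed.

HB.instance Definition _ (gT : groupType) (S : set gT) :=
  SubChoice_isSubGroup.Build gT _ (generated_group S) (generated_closed S).

Definition left_coset (gT : groupType) (g : gT) (H : set gT) : set gT :=
  [set (g * h)%g | h in H].

Definition finite_index (gT : groupType) (H : set gT) : Prop :=
  is_subgroup H /\ finite_set [set left_coset g H | g in [set: gT]].

(* Universal property of a free group on X: every map from X to a group K
   extends to exactly one morphism. Maps on X are represented by total
   functions f, of which only the restriction to X is used. *)
Definition free_basis (G : groupType) (X : set G) : Prop :=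
  forall (K : groupType) (f : G -> K),
    exists phi : {multiplicative G -> K},
      {in X, phi =1 f} /\
      (forall psi : {multiplicative G -> K}, {in X, psi =1 f} -> psi =1 phi).

Definition free_group (G : groupType) : Prop :=
  exists X : set G, free_basis X.

(* Main.v *)
Require Import Defs.
From mathcomp Require Import all_boot all_order all_algebra.
From mathcomp Require Import boolp classical_sets functions cardinality.

Set Implicit Arguments.
Unset Strict Implicit.
Unset Printing Implicit Defensive.

Import GRing.Theory Num.Theory.

Local Open Scope classical_set_scope.
Local Open Scope ring_scope.

(** In SL(2, Z[1/b]) the diagonal matrix D = diag(b, 1/b) satisfies
    D A(1) = A(1)^(b^2) D. Some positive powers t = D^k and x = A(1)^n lie in
    the given subgroup of finite index, by the pigeonhole principle applied to
    the cosets of the powers of D and of A(1) ([finite_index_pow]), and they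
    satisfy t x = x^q t with q = (b^2)^k > 1, while x is not the identity.
    In a free group such a relation forces x = 1 ([free_group_conj_pow]), so
    the subgroup is not free.

    The fact on free groups is proved by mapping to unitriangular integer
    matrices, where the same relation is impossible for x <> 1: if x - 1
    vanishes below the d-th superdiagonal, then comparing the entries of t x
    and of x^q t on that superdiagonal shows that those of x - 1 equal q times
    themselves, hence vanish ([unitriangular_conj_pow]).

    It remains to find, for each x <> 1 in a free group, a unitriangular
    representation in which x is not trivial. This is Magnus's argument. Write
    x as a reduced word y_0^n_0 ... y_(k-1)^n_(k-1), with consecutive letters
    distinct and nonzero exponents ([free_basis_reduced]). Send a letter y to
    1 + N_y, where N_y is the sum of the elementary matrices E_(i,i+1) over the
    positions i at which y occurs in the word. Since consecutive letters
    differ, N_y^2 = 0, so y^n is sent to 1 + n N_y. Each of the k factors of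
    the image of x moves an index by at most one step, so its corner entry
    (0, k) is the product of the n_i ([syllables_mx_corner]), which is not
    zero. *)

(** * Integer powers in a group *)

Section IntegerPowers.
Local Open Scope group_scope.
Variable G : groupType.
Implicit Types (x : G) (n m : int).

Definition expgz x n : G :=
  match n with Posz k => x ^+ k | Negz k => x ^- k.+1 end.

Lemma expgzS x n : expgz x (n + 1)%R = expgz x n * x.
Proof.
case: n => [k|[|k]].
- have -> : (k%:Z + 1)%R = k.+1%:Z by rewrite -PoszD addn1.
  by rewrite /expgz expgSr.
- by rewrite /expgz NegzE addNr expg1 mulVg.
- have -> : (Negz k.+1 + 1)%R = Negz k.
    by rewrite !NegzE -(addn1 k.+1) PoszD opprD addrNK.
  by rewrite /expgz (expgS _ k.+1) invgM mulgVK.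
Qed.

Lemma expgzD x n m : expgz x (n + m)%R = expgz x n * expgz x m.
Proof.
elim/int_ind: m => [|k IHk|k IHk]; first by rewrite addr0 mulg1.
- by rewrite -addn1 PoszD addrA !expgzS IHk mulgA.
- apply: (mulIg x); rewrite -mulgA -!expgzS.
  by rewrite -addn1 PoszD opprD -addrA addrNK.
Qed.

End IntegerPowers.

(** The integer powers of an element are determined by additivity in the
    exponent; this turns each computation of a power below into the
    verification of one addition formula. *)
Lemma expgz_additive (G : groupType) (f : int -> G) :
  (forall n m : int, f (n + m) = (f n * f m)%g) ->
  forall n, expgz (f 1) n = f n.
Proof.
move=> fD; elim/int_ind => [|k IHk|k IHk].
- by apply: (mulgI (f 0)); rewrite -fD addr0 mulg1.
- by rewrite -addn1 PoszD expgzS fD IHk.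
- apply: (mulIg (f 1)); rewrite -expgzS -fD.
  by rewrite -addn1 PoszD opprD addrNK.
Qed.

Lemma gmulf_expgz (G H : groupType) (phi : {multiplicative G -> H}) (x : G) n :
  phi (expgz x n) = expgz (phi x) n.
Proof.
rewrite -(@expgz_additive _ (fun n => phi (expgz x n))) // => {}n m.
by rewrite expgzD gmulfM.
Qed.

(** * Reduced words over a free basis *)

Section Words.
Local Open Scope group_scope.
Variables (G : groupType) (X : set G).
Implicit Types (w : seq (G * int)).

Definition word_val w : G := foldr (fun s g => expgz s.1 s.2 * g) 1 w.

(** An entry (y, n) stands for the syllable y^n. Free reduction is imposed on
    syllables rather than on letters, because the square-zero property of the
    matrices attached to a word needs consecutive letters to be distinct. *)
Definition reduced w : bool :=
  [&& all (fun s => s.1 \in X) w, all (fun s => s.2 != 0%R) w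
    & sorted (fun s t => s.1 != t.1) w].

Lemma reduced_consP s w : reduced (s :: w) =
  [&& s.1 \in X, s.2 != 0%R, all (fun t => s.1 != t.1) (take 1 w) & reduced w].
Proof.
rewrite /reduced; case: w => [|t w] /=; first by rewrite !andbT.
by rewrite ?take0 ?andbT; case: (s.1 \in X); case: (s.2 != 0%R);
  case: (t.1 \in X); case: (t.2 != 0%R); case: (s.1 != t.1);
  rewrite /= ?andbF ?andbT.
Qed.

(** The syllable y^n is prepended, merged with the first syllable when the
    letters agree, or cancelled with it when the exponents are also opposite;
    in the last case the rest of the word is again reduced. *)
Lemma reduced_mul_letter y (n : int) w : y \in X -> n != 0%R -> reduced w ->
  exists2 w', reduced w' & word_val w' = expgz y n * word_val w.
Proof.
move=> yX n0 rw; case: w rw => [|[z m] w] rw.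
  by exists [:: (y, n)]; rewrite // reduced_consP /= yX n0.
have [yz|yz] := eqVneq y z; last first.
  by exists ((y, n) :: (z, m) :: w); rewrite // reduced_consP /= take0 yX n0 yz rw.
move: rw; rewrite -yz reduced_consP => /and4P[_ _ hd rw].
have [nm|nm] := eqVneq (n + m)%R 0%R.
  by exists w; rewrite //= mulgA -expgzD nm mul1g.
exists ((y, (n + m)%R) :: w); first by rewrite reduced_consP yX nm hd rw.
by rewrite /= expgzD mulgA.
Qed.

(** A free basis generates. The inclusion of X into the subgroup <X> extends to
    a morphism phi from G to <X>. Composed with the inclusion of <X> into G, it
    fixes X, so it is the identity by uniqueness. *)
Lemma free_basis_ind (S : set G) : free_basis X -> is_subgroup S ->
  X `<=` S -> forall g, S g.
Proof.
move=> fX SG XS g.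
have [phi [phiX _]] := fX (generated_group X) (insubd 1).
have [idG [_ idG_uniq]] := fX G id.
have e1 : (fun g => val (phi g)) =1 idG.
  pose psi : {multiplicative G -> G} := val \o phi.
  (* On X the default value of insubd is not reached. *)
  apply: (idG_uniq psi) => y yX /=; rewrite phiX // val_insubd.
  case: ifP => // /negP[]; rewrite inE => H [_]; apply.
  by rewrite inE in yX.
pose i : {multiplicative G -> G} := idfun.
have e2 : i =1 idG by apply: idG_uniq.
have -> : g = val (phi g) by rewrite e1 -e2.
by have := valP (phi g); rewrite inE; apply; split.
Qed.

(** Induction on generators applies to subgroups only, and the set S of values
    of reduced words is not visibly one. The set T of the elements g such that
    both g and its inverse map S into S by left multiplication is one, it
    contains X, and S contains T because 1 is the value of the empty word. *)
Lemma free_basis_reduced : free_basis X ->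
  forall g, exists2 w, reduced w & word_val w = g.
Proof.
move=> fX g.
pose S g := exists2 w, reduced w & word_val w = g.
pose T : set G := [set g | forall h, S h -> S (g * h) /\ S (g^-1 * h)].
suff /(_ 1)[] : T g by rewrite ?mulg1 //; exists [::].
apply: (@free_basis_ind T fX); last first.
  move=> y yX _ [w rw <-]; rewrite -inE in yX.
  split; first by have [|w' rw' e] := @reduced_mul_letter y 1 w yX _ rw;
    [|exists w'].
  by have [|w' rw' e] := @reduced_mul_letter y (- 1)%R w yX _ rw;
    [|exists w'].
split=> [|u v]; rewrite !inE /=; first by move=> h; rewrite invg1 !mul1g.
move=> Tu Tv h Sh; rewrite invgF -!mulgA; split.
  exact: (Tu _ (Tv _ Sh).2).1.
exact: (Tv _ (Tu _ Sh).2).1.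
Qed.

End Words.

(** * Unitriangular matrices *)

Section Band.
Variables (R : numDomainType) (k : nat).
Implicit Types M N : 'M[R]_k.+1.

(** The matrices supported on or above the d-th superdiagonal form a filtration:
    the analogue of the powers of the augmentation ideal. *)
Definition band (d : nat) M := forall i j : 'I_k.+1, (j < i + d)%N -> M i j = 0.

Lemma band0 d : band d 0.
Proof. by move=> i j _; rewrite mxE. Qed.

Lemma bandD d M N : band d M -> band d N -> band d (M + N).
Proof. by move=> bM bN i j h; rewrite mxE bM ?bN ?addr0. Qed.

Lemma bandN d M : band d M -> band d (- M).
Proof. by move=> bM i j h; rewrite mxE bM ?oppr0. Qed.

Lemma bandMn d M n : band d M -> band d (M *+ n).
Proof.
by move=> bM; elim: n => [|n IH]; rewrite ?mulrS; [exact: band0|exact: bandD].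
Qed.

Lemma bandM d e M N : band d M -> band e N -> band (d + e) (M * N).
Proof.
move=> bM bN i j h; rewrite mxE big1 // => l _.
have [li|li] := ltnP l (i + d); first by rewrite bM ?mul0r.
by rewrite bN ?mulr0 // (leq_trans h) // addnA leq_add2r.
Qed.

Lemma bandW d e M : (e <= d)%N -> band d M -> band e M.
Proof. by move=> ed bM i j h; rewrite bM // (leq_trans h) // leq_add2l. Qed.

Lemma band_eq0 M : band k.+1 M -> M = 0.
Proof.
move=> bM; apply/matrixP=> i j.
by rewrite mxE bM // (leq_trans (ltn_ord j)) ?leq_addl.
Qed.

(** Modulo terms of higher degree, (1 + u)^n is 1 + n u. *)
Lemma bandX d u n : band d.+1 u ->
  band d.+1 ((1 + u) ^+ n - 1) /\ band d.+2 ((1 + u) ^+ n - 1 - u *+ n).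
Proof.
move=> bu; elim: n => [|n [b1 b2]].
  by rewrite expr0 subrr mulr0n subr0; split; exact: band0.
suff H : band d.+2 ((1 + u) ^+ n.+1 - 1 - u *+ n.+1).
  split=> //; rewrite -[_ - 1](subrK (u *+ n.+1)).
  by apply: bandD (bandMn _ bu); apply: bandW H.
have -> : (1 + u) ^+ n.+1 - 1 - u *+ n.+1 =
    ((1 + u) ^+ n - 1 - u *+ n) + ((1 + u) ^+ n - 1) * u.
  rewrite exprSr mulrDr mulr1 mulrBl mul1r mulrSr opprD addrA [RHS]addrA.
  by congr (_ - u); rewrite (addrAC _ _ (- 1)) (addrAC _ _ (- (u *+ n))).
apply: bandD b2 _; apply: (@bandW (d.+1 + d.+1)); last exact: bandM.
by rewrite addSn addnS !ltnS leq_addl.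
Qed.

(** Put u = x - 1 and s = t - 1. If u has degree d, then t x - t = u + s u
    agrees with u, and (x^q - 1) t with q u, up to degree d + 1. So (q - 1) u has
    degree d + 1, and so does u. *)
Lemma unitriangular_conj_pow (t x : 'M[R]_k.+1) q : (1 < q)%N ->
  band 1 (t - 1) -> band 1 (x - 1) -> t * x = x ^+ q * t -> x = 1.
Proof.
move=> q1 bt bx e; set s := t - 1 in bt; set u := x - 1 in bx.
have xE : x = 1 + u by rewrite addrC subrK.
have tE : t = 1 + s by rewrite addrC subrK.
suff bu d : band d.+1 u by rewrite xE (band_eq0 (bu k)) addr0.
elim: d => // d IH; have [b1 b2] := bandX q IH.
have q1E : u *+ q.-1 = s * u - ((1 + u) ^+ q - 1 - u *+ q)
     - ((1 + u) ^+ q - 1) * s.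
  rewrite -xE; set v := x ^+ q - 1.
  have e' : u + s * u = v + v * s.
    rewrite -[X in X + _]mul1r -mulrDl -[X in _ = X + _]mulr1 -mulrDr -tE.
    by rewrite mulrBr mulr1 e mulrBl mul1r.
  have -> : u *+ q = u + u *+ q.-1 by rewrite -mulrS (prednK (ltnW q1)).
  rewrite opprB addrA addrA [s * u + u]addrC e' -[_ - v - _]addrA.
  by rewrite -opprD [_ + u *+ _]addrC addrK.
have bq : band d.+2 (u *+ q.-1).
  rewrite q1E; apply: bandD; last first.
    by apply: bandN; rewrite -[d.+2]addn1; exact: bandM.
  by apply: bandD; [rewrite -[d.+2]add1n; exact: bandM|exact: bandN].
move=> i j h; have := bq i j h; rewrite mulmxnE => /eqP.
by rewrite mulrn_eq0 -subn1 subn_eq0 leqNgt q1 => /eqP.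
Qed.

End Band.

Lemma det_unitriangular (R : numDomainType) k (M : 'M[R]_k.+1) :
  band 1 (M - 1) -> \det M = 1.
Proof.
move=> bM; have ME (i j : 'I_k.+1) : (j <= i)%N -> M i j = (i == j)%:R.
  move=> ji; have := bM i j; rewrite addn1 ltnS => /(_ ji).
  by rewrite !mxE => /eqP; rewrite subr_eq0 => /eqP.
rewrite -det_tr det_trig; last first.
  by apply/is_trig_mxP => i j ij; rewrite mxE (ME _ _ (ltnW ij)) -val_eqE gtn_eqF.
by rewrite big1 // => i _; rewrite mxE ME // eqxx.
Qed.

(** * The Magnus representation attached to a word *)

Section Magnus.
Variables (G : groupType) (w : seq (G * int)).
Let k := size w.
Implicit Types (y : G) (l : seq (G * int)).

(** The matrix N_y. The condition j = i + 1 <= k forces i < k, so that [nth]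
    reads an actual letter of the word. *)
Definition letter_mx y : 'M[int]_k.+1 :=
  \matrix_(i, j) ((j == i.+1 :> nat) && ((nth (1%g, 0) w i).1 == y))%:R.

Lemma letter_mxM y (M : 'M[int]_k.+1) (i j : 'I_k.+1) : (i < k)%N ->
  (letter_mx y * M) i j = ((nth (1%g, 0) w i).1 == y)%:R * M (inord i.+1) j.
Proof.
move=> ik; rewrite mxE (bigD1 (inord i.+1)) //= mxE inordK ?ltnS // eqxx.
rewrite big1 ?addr0 // => m mi; rewrite mxE; case: eqP => [e|_]; last first.
  by rewrite mul0r.
by rewrite -e inord_val eqxx in mi.
Qed.

Lemma letter_mx_band y n : band 1 (1 + letter_mx y *~ n - 1).
Proof.
rewrite addrC addKr => i j; rewrite addn1 => ji.
by rewrite -scaler_int !mxE [j == _ :> nat]ltn_eqF ?mulr0.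
Qed.

Definition syllable_SL y (n : int) : SL k.+1 int :=
  MkSL (introT eqP (det_unitriangular (letter_mx_band y n))).

Definition syllables_mx l : 'M[int]_k.+1 :=
  \prod_(s <- l) (1 + letter_mx s.1 *~ s.2).

Lemma syllables_mx_band l : band 1 (syllables_mx l - 1).
Proof.
rewrite /syllables_mx; elim: l => [|s l IH].
  by rewrite big_nil subrr; exact: band0.
rewrite big_cons; set P := 1 + _; set Q := \big[_/_]_(_ <- _) _.
have -> : P * Q - 1 = (P - 1) * (Q - 1) + (P - 1) + (Q - 1).
  by rewrite mulrBr mulr1 subrK mulrBl mul1r addrA subrK.
apply: (bandD _ IH); apply: bandD; last exact: letter_mx_band.
by apply: (@bandW _ _ (1 + 1)) => //; apply: (bandM _ IH); exact: letter_mx_band.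
Qed.

(** Column k of the matrix of a suffix w_p ... w_(k-1) is computed by induction
    on the suffix: its entries in rows i < p vanish, as k - i steps are more
    than there are factors, and the entry in row p is the product of the
    exponents. *)
Lemma syllables_mx_corner :
  syllables_mx w ord0 ord_max = \prod_(s <- w) s.2.
Proof.
suff H l p (i : 'I_k.+1) : w = p ++ l -> (i <= size p)%N ->
    syllables_mx l i ord_max = \prod_(s <- l) s.2 *+ (i == size p :> nat).
  by rewrite (H w [::] ord0).
rewrite /syllables_mx; elim: l p i => [|s l IH] p i wE ip.
  have -> : size p = k by rewrite [in RHS]/k wE cats0.
    by rewrite !big_nil mxE -val_eqE.
have wE' : w = rcons p s ++ l by rewrite cat_rcons.
have pk : (size p < k)%N by rewrite /k wE size_cat /= addnS ltnS leq_addr.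
have ik : (i < k)%N := leq_ltn_trans ip pk.
rewrite !big_cons mulrDl mul1r mxE (IH _ _ wE') size_rcons ?(leqW ip) //.
rewrite ltn_eqF ?ltnS // mulr0n add0r mulrzAl -scaler_int mxE letter_mxM //.
rewrite (IH _ _ wE') inordK ?ltnS // size_rcons ?ltnS // eqSS.
have [->|_] := eqVneq (i : nat) (size p); last by rewrite !mulr0n !mulr0.
by rewrite wE nth_cat ltnn subnn eqxx mul1r !mulr1n intz.
Qed.

(** A nonzero entry of the square needs y at two consecutive positions. *)
Lemma letter_mx_sqr y : sorted (fun s t => s.1 != t.1) w ->
  letter_mx y * letter_mx y = 0.
Proof.
move=> w_adj.
apply/matrixP => i j; rewrite [RHS]mxE.
have [ik|ki] := ltnP i k; last first.
  rewrite mxE big1 // => m _; rewrite mxE [m == _ :> nat]ltn_eqF ?mul0r //.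
  by rewrite (leq_trans (ltn_ord m)).
rewrite letter_mxM // mxE inordK ?ltnS //.
case: eqP => [iy|]; last by rewrite mul0r.
case: eqP => [ji|]; last by rewrite mulr0.
have ik' : (i.+1 < size w)%N by rewrite -ltnS -ji ltn_ord.
have := sortedP (1%g, 0) w_adj i ik'.
by rewrite iy eq_sym => /negPf ->; rewrite mulr0.
Qed.

Lemma expgz_syllable y n : sorted (fun s t => s.1 != t.1) w ->
  expgz (syllable_SL y 1) n = syllable_SL y n.
Proof.
move=> w_adj.
apply: (expgz_additive (f := syllable_SL y)) => {}n m; apply: val_inj => /=.
rewrite -[RHS]/(_ * _) mulrDl mul1r mulrDr mulr1 mulrzAl mulrzAr.
by rewrite letter_mx_sqr // !mul0rz addr0 mulrzDr addrA addrAC.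
Qed.

End Magnus.

(** * Baumslag-Solitar relations *)

(** In the Magnus representation attached to a reduced word of x, the relation
    makes the image of x trivial, while its corner entry is the product of the
    exponents, which is not zero. If the word is not empty, the corner entry of
    the identity matrix is zero, a contradiction. *)
Lemma free_group_conj_pow (G : groupType) (t x : G) q :
  free_group G -> (1 < q)%N -> (t * x = x ^+ q * t)%g -> x = 1%g.
Proof.
move=> [X fX] q1 e; have [w rw wx] := free_basis_reduced fX x.
have /and3P[wX w0 w_adj] := rw.
have [phi [phiX _]] := fX (SL (size w).+1 int) (fun y => syllable_SL w y 1).
have phiE l : reduced X l -> SL_mx (phi (word_val l)) = syllables_mx w l.
  move=> /and3P[lX _ _]; rewrite /syllables_mx.
  elim: l lX => [|s l IH] /= => [_|/andP[sX lX]].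
    by rewrite big_nil -[1%g]/(expgz x 0) gmulf_expgz.
  by rewrite big_cons gmulfM gmulf_expgz (phiX _ sX) expgz_syllable //= IH.
have phi_band g : band 1 (SL_mx (phi g) - 1).
  by have [l rl <-] := free_basis_reduced fX g; rewrite phiE //;
    exact: syllables_mx_band.
have powE (g : SL (size w).+1 int) n : SL_mx (g ^+ n)%g = SL_mx g ^+ n.
  by elim: n => // n IH; rewrite expgS exprS -IH.
have phiXq : phi (x ^+ q)%g = (phi x ^+ q)%g := gmulf_expgz phi x q.
have x1 : SL_mx (phi x) = 1.
  apply: (unitriangular_conj_pow q1 (phi_band t) (phi_band x)).
  have := congr1 (fun g => SL_mx (phi g)) e.
  by rewrite !gmulfM -powE -phiXq.
have := syllables_mx_corner w; rewrite -phiE // wx x1 mxE -wx -val_eqE /=.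
case: w {rw wx wX w_adj phi phiX phiE phi_band powE phiXq x1} w0 => // s w w0 p0.
have : \prod_(u <- s :: w) u.2 != 0.
  by rewrite prodf_seq_neq0; apply: sub_all w0 => u ->.
by rewrite -p0 eqxx.
Qed.

Lemma conj_powX (G : groupType) (t x : G) q k n :
  (t * x = x ^+ q * t)%g ->
  (t ^+ k * x ^+ n = (x ^+ n) ^+ (q ^ k) * t ^+ k)%g.
Proof.
move=> e; have en m : (t * x ^+ m = (x ^+ m) ^+ q * t)%g.
  elim: m => [|m IH]; first by rewrite !expg0 expg1n mulg1 mul1g.
  by rewrite [in LHS]expgS mulgA e -mulgA IH mulgA -!expgnA -expgnDr -mulSn.
elim: k => [|k IH]; first by rewrite mul1g mulg1.
by rewrite expgS -mulgA IH mulgA -!expgnA en !expgnA -!mulgA -expgS -!expgnA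
  -mulnA -expnSr.
Qed.

(** Two of the cosets g^i H coincide, and g^(j - i) then lies in H. *)
Lemma finite_index_pow (G : groupType) (H : set G) (g : G) :
  finite_index H -> exists2 n, (0 < n)%N & H (g ^+ n)%g.
Proof.
move=> [[H1 HF] /finite_seqP[s sE]].
pose c n := left_coset (g ^+ n)%g H.
have /uniqPn : ~~ uniq (map c (iota 0 (size s).+1)).
  apply/negP => /uniq_leq_size le_size; suff /le_size :
      {subset [seq c n | n <- iota 0 (size s).+1] <= s}.
    by rewrite size_map size_iota ltnn.
  move=> _ /mapP[n _ ->].
  by suff : [set` s] (c n) by []; rewrite -sE; exists (g ^+ n)%g.
move=> /(_ (c 0%N)) [i [j [ij]]]; rewrite size_map size_iota => js.
rewrite !(nth_map 0%N) ?size_iota ?(ltn_trans ij) // !nth_iota ?(ltn_trans ij) //.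
rewrite !add0n => cij.
have : c j (g ^+ j)%g by exists 1%g; rewrite ?mulg1 // -inE.
rewrite -cij => -[h Hh hE]; exists (j - i)%N; first by rewrite subn_gt0.
suff -> : (g ^+ (j - i) = h)%g by [].
by apply: (mulgI (g ^+ i)%g); rewrite hE -expgnDr subnKC // ltnW.
Qed.

(** * The diagonal and unipotent elements of SL(2) *)

Section SL2.
Variable R : comNzRingType.

Lemma mul_mx2 (a b c d a' b' c' d' : R) : mx2 a b c d *m mx2 a' b' c' d' =
  mx2 (a * a' + b * c') (a * b' + b * d') (c * a' + d * c') (c * b' + d * d').
Proof.
apply/matrixP => i j; rewrite !mxE !big_ord_recl big_ord0 addr0 !mxE /=.
by case: i j => [[|[|i]] hi] [[|[|j]] hj].
Qed.

Lemma A_exp (x : R) n : (A x ^+ n)%g = A (x *+ n).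
Proof.
elim: n => [|n IH]; apply: val_inj.
  apply/matrixP => i j; rewrite !mxE.
  by case: i j => [[|[|i]] hi] [[|[|j]] hj].
rewrite expgS IH /= mul_mx2 !mulr1 !mul1r !mul0r !mulr0 !addr0 !add0r.
by rewrite mulrSr.
Qed.

Lemma diag_subproof (u v : R) : u * v = 1 -> \det (mx2 u 0 0 v) == 1.
Proof. by rewrite det_mx2 mulr0 subr0 => ->. Qed.

Definition diag_SL (u v : R) (uv : u * v = 1) : SL 2 R := MkSL (diag_subproof uv).

Lemma diag_conj_A n (v : R) (uv : n%:R * v = 1) :
  (diag_SL uv * A 1 = A 1 ^+ (n ^ 2) * diag_SL uv)%g.
Proof.
rewrite A_exp; apply: val_inj; rewrite /= !mul_mx2.
by rewrite !mulr1 !mul1r !mul0r !mulr0 !addr0 !add0r natrX expr2 -mulrA uv mulr1.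
Qed.

End SL2.

Theorem proposition2p3 (a b : nat) (hb : (1 < b)%N) (ha : (0 < a)%N)
    (hab : coprime a b) :
  let m : Zinv b := Zfrac b a%:Z 1 in
  let AB : set (SL 2 (Zinv b)) := [set A m; B m] in
  finite_index (generated AB) -> ~ free_group (generated_group AB).
Proof.
move=> m AB fin free.
have val_nat n : Zinv_val (n%:R : Zinv b) = n%:R.
  by rewrite -[Zinv_val _]/(val _) rmorph_nat.
have b_unit : b%:R * Zfrac b 1 1 = 1 :> Zinv b.
  apply: val_inj; rewrite rmorphM rmorph1 /= val_nat div1r divff //.
  by rewrite pnatr_eq0 -lt0n ltnW.
have [k k0 Dk] := finite_index_pow (diag_SL b_unit) fin.
have [n n0 An] := finite_index_pow (A 1) fin.
rewrite -inE in Dk; rewrite -inE in An.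
have q1 : (1 < (b ^ 2) ^ k)%N
  by rewrite -expnM (leq_ltn_trans _ (ltn_expl _ hb)) // muln_gt0.
pose t : generated_group AB := MkGenerated Dk.
pose x : generated_group AB := MkGenerated An.
have rel : (t * x = x ^+ ((b ^ 2) ^ k) * t)%g.
  have valX i : generated_val (x ^+ i)%g = ((A 1 ^+ n) ^+ i)%g.
    exact: (gmulfXn val).
  apply: val_inj; rewrite -[RHS]/(generated_val (x ^+ _) * generated_val t)%g valX.
  exact/conj_powX/diag_conj_A.
(* The upper right entry of x is n, which is nonzero in characteristic 0. *)
have := congr1 (fun g => SL_mx (val g) ord0 ord_max)
  (free_group_conj_pow free q1 rel).
rewrite /= A_exp !mxE /= => /(congr1 val)/eqP.
by rewrite rmorphMn rmorph1 rmorph0 pnatr_eq0 eqn0Ngt n0.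
Qed.
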